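(* Let $q$ be even, $t\ge 3$ a prime, $q\ge t$. In $\mathrm{PG}(2,q^t)$, let $\mathcal C$ be a conic and let $\mathcal D$ be an André set of $\ell_\infty$. For $m\in\{1,\ldots,t-1\}$ perform an André replacement using the André replacement net $\mathcal D^m$, and let $\mathcal D_m(\mathcal C)$ denote the set of points in the André plane $\mathcal P(\mathcal D^m)$ corresponding to the affine points of $\mathcal C$. If $\mathcal C$ has nucleus $N$ and is tangent to the line $\ell_\infty$ at the point $T$, with $T,N\in\mathcal D$, then $\mathcal D_m(\mathcal C)$ is not an arc in $\mathcal P(\mathcal D^m)$ for any $m\in\{1,\ldots,t-1\}$.
   Context: Conics are non-degenerate. As $q$ is even, all tangent lines of a conic pass through a common point, its nucleus. Homogeneous coordinates of $\mathrm{PG}(2,q^t)$ are $(x,y,z)$, with $\ell_\infty$ the line $z=0$; the point $(x,y,0)$ of $\ell_\infty\cong\mathrm{PG}(1,q^t)$ is also written $(x,y)$. Affine points are the points not on $\ell_\infty$; $(x,y,1)$ is identified with the vector $(x,y)\in V=\mathbb F_{q^t}^2$. An arc of a projective plane is a set of points, no three collinear. Norm: $\mathrm N(k)=k^{1+q+\cdots+q^{t-1}}$ for $k\in\mathbb F_{q^t}$. André sets: for distinct points $E,F$ of $\mathrm{PG}(1,q^t)$, let $G\le \mathrm{PGL}(2,q^t)$ be the group (cyclic of order $q^t-1$) of projectivities fixing both $E$ and $F$, and $H$ its unique subgroup of order $q^{t-1}+\cdots+q+1$. The $q-1$ orbits of $H$ on $\mathrm{PG}(1,q^t)\setminus\{E,F\}$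 are the André sets with transversal points $E,F$. The André sets with transversal points $(1,0),(0,1)$ are $\mathcal A_\delta=\{(1,\theta)\mid \theta\in\mathbb F_{q^t}^*,\ \mathrm N(\theta)=\delta\}$, $\delta\in\mathbb F_q^*$, and every André set is the image of such a set under a projectivity. Bruck–Bose representation: regard $V$ as a $2t$-dimensional $\mathbb F_q$-space, so affine points of $\mathrm{PG}(2,q^t)$ are the points of $\mathrm{AG}(2t,q)$. A point $P=(x,y)$ of $\ell_\infty$ corresponds to the $t$-dimensional $\mathbb F_q$-subspace $[P]=\{(sx,sy)\mid s\in\mathbb F_{q^t}\}$ of $V$ (projectively a $(t-1)$-space of the hyperplane at infinity $\mathrm{PG}(2t-1,q)$); the affine lines through $P$ are the cosets of $[P]$. André replacement nets: for $\mathcal D=\mathcal A_\delta$ and $m\in\{1,\ldots,t-1\}$, $\mathcal D^m=\{X_{m,u}\mid u\in\mathbb F_{q^t}^*,\mathrm N(u)=\delta\}$ where $X_{m,u}=\{(s,s^{q^m}u)\mid s\in\mathbb F_{q^t}\}$, a $t$-dimensional $\mathbb F_q$-subspace of $V$. For a general André set $\mathcal D$, choose $\varphi\in\mathrm{GL}(2,q^t)$ inducing a projectivity mapping some $\mathcal A_\delta$ to $\mathcal D$; the $t-1$ replacement nets of $\mathcal D$ are $\mathcal D^m=\{\varphi(X_{m,u})\}$, the images of those of $\mathcal A_\delta$. André replacement: a $\mathcal D^m$-block is a coset in $V$ of a member of $\mathcal D^m$. The incidence structure whose points are the affine points of $\mathrm{PG}(2,q^t)$ and whose lines are the affine lines of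 $\mathrm{PG}(2,q^t)$ meeting $\ell_\infty$ in a point not in $\mathcal D$, together with the $\mathcal D^m$-blocks, is an affine plane of order $q^t$; its projective completion is the André plane $\mathcal P(\mathcal D^m)$. *)

(* Defs.v *)
From HB Require Import structures.
From mathcomp Require Import all_boot all_order all_algebra all_fingroup.

Set Implicit Arguments.
Unset Strict Implicit.
Unset Printing Implicit Defensive.

Import GRing.Theory.
Local Open Scope ring_scope.

Section FiniteVspace.
Import VectorInternalTheory.
Variables (K : finFieldType) (vT : vectType K).
HB.instance Definition _ := [Countable of {vspace vT} by <:].
HB.instance Definition _ := [Finite of {vspace vT} by <:].
End FiniteVspace.

Section ProjectiveSpace.
Variable K : finFieldType.

Definition PG (n : nat) : Type := {P : {vspace 'rV[K]_n.+1} | \dim P == 1%N}.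
HB.instance Definition _ n := Finite.on (PG n).

Definition vpt n (v : 'rV[K]_n.+1) (v0 : v != 0) : PG n.
Proof. by exists <[v]>%VS; rewrite dim_vline v0. Defined.

Definition lines2 : {set {set PG 2}} :=
  [set [set P : PG 2 | (val P <= U)%VS]
     | U : {vspace 'rV[K]_3} in [pred U | \dim U == 2%N]].

(* The line z = 0. *)
Definition linf : {set PG 2} :=
  [set P : PG 2 | [forall v : 'rV[K]_3, (v \in val P) ==> (v 0 ord_max == 0)]].

(* (x, y) is sent to (x, y, 0). *)
Definition to_inf (v : 'rV[K]_2) : 'rV[K]_3 := row_mx v (0 : 'rV_1).

Fact to_inf_is_linear : linear to_inf.
Proof.
move=> a u v; rewrite /to_inf (@scale_row_mx _ 1 2 1).
by rewrite (@add_row_mx _ 1 2 1) scaler0 addr0.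
Qed.
HB.instance Definition _ :=
  GRing.isLinear.Build K 'rV[K]_2 'rV[K]_3 _ to_inf to_inf_is_linear.

Fact to_inf_inj : injective to_inf.
Proof. by move=> u v /(@eq_row_mx _ 1 2 1)[]. Qed.

(* The identification of PG(1, K) with the line at infinity of PG(2, K). *)
Definition inf_pt (P : PG 1) : PG 2.
Proof.
exists (linfun to_inf @: val P)%VS; rewrite limg_dim_eq ?(valP P) //.
apply/eqP; rewrite -subv0; apply/subvP=> v /memv_capP[_].
rewrite memv_ker lfunE memv0 /= => /eqP v0.
by apply/eqP/to_inf_inj; rewrite v0 linear0.
Defined.

(* The affine point (x, y, 1), identified with the vector (x, y). *)
Definition aff_pt (v : 'rV[K]_2) : PG 2.
Proof.
apply: (@vpt 2 (row_mx v (1 : 'rV_1))).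
apply/eqP => /rowP /(_ (rshift 2 ord0)).
by rewrite (@row_mxEr _ 1 2 1) !mxE eqxx => /eqP; rewrite oner_eq0.
Defined.

(* GL(2, K) acts on row vectors by v |-> v *m phi. *)
Definition projectivity_of (phi : {'GL_2[K]}) (P : PG 1) : PG 1.
Proof.
exists (linfun (mulmxr (GLval phi)) @: val P)%VS; rewrite limg_dim_eq ?(valP P) //.
apply/eqP; rewrite -subv0; apply/subvP=> v /memv_capP[_].
rewrite memv_ker lfunE memv0 /= => /eqP v0.
have phiU : GLval phi \in unitmx by exact: GL_unitmx.
by rewrite -(mulmxK phiU v) v0 mul0mx.
Defined.

Definition PGL2 : {set {perm PG 1}} :=
  [set s : {perm PG 1} |
     [exists phi : {'GL_2[K]}, [forall P, s P == projectivity_of phi P]]].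

Definition quad (A : 'M[K]_3) (v : 'rV[K]_3) : K := (v *m A *m v^T) 0 0.

Definition polar (A : 'M[K]_3) (v w : 'rV[K]_3) : K :=
  quad A (v + w) - quad A v - quad A w.

(* A may be any matrix, so that every quadratic form is covered also in
   characteristic 2.  The form is non-degenerate when its zero set has no
   singular point. *)
Definition nondegenerate_quad (A : 'M[K]_3) : Prop :=
  forall v : 'rV[K]_3,
    quad A v = 0 -> (forall w, polar A v w = 0) -> v = 0.

Definition is_conic (C : {set PG 2}) : Prop :=
  exists2 A : 'M[K]_3, nondegenerate_quad A &
    C = [set P : PG 2 | [forall v : 'rV[K]_3, (v \in val P) ==> (quad A v == 0)]].

Definition tangent_at (C l : {set PG 2}) (T : PG 2) : Prop :=
  l \in lines2 /\ C :&: l = [set T].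

Definition is_nucleus (C : {set PG 2}) (N : PG 2) : Prop :=
  forall l T, tangent_at C l T -> N \in l.

Definition affine_part (S : {set PG 2}) : {set 'rV[K]_2} :=
  [set v | aff_pt v \in S].

End ProjectiveSpace.

Section IncidencePlanes.

Definition is_arc (pt : finType) (lines : {set {set pt}}) (S : {set pt}) : Prop :=
  forall x y z, x \in S -> y \in S -> z \in S ->
    x != y -> y != z -> x != z ->
    ~ exists2 l, l \in lines & [/\ x \in l, y \in l & z \in l].

Variables (pt : finType) (lines : {set {set pt}}).

Definition parallel (l m : {set pt}) : bool := (l == m) || [disjoint l & m].

Definition pclass (l : {set pt}) : {set {set pt}} :=
  [set m in lines | parallel l m].

(* The points of the completion are the affine points and the parallel classes;
   the elements of the right summand that are not parallel classes lie on no
   line. *)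
Definition completion_lines : {set {set (pt + {set {set pt}})}} :=
  [set inr @: [set pclass l | l in lines]]
    :|: [set inr (pclass l) |: (inl @: l) | l in lines].

End IncidencePlanes.

Section Andre.
(* K is the field with q ^ t elements, and its subfield with q elements is the
   set of the k such that k ^+ q = k. *)
Variables (K : finFieldType) (q t : nat).

Definition norm (k : K) : K := k ^+ (\sum_(i < t) q ^ i)%N.

Definition vec2 (x y : K) : 'rV[K]_2 := row_mx (x%:M : 'rV_1) (y%:M : 'rV_1).

Definition pgroup_fixing (E F : PG K 1) : {set {perm PG K 1}} :=
  [set s in PGL2 K | (s E == E) && (s F == F)].

Definition is_andre_set (D : {set PG K 1}) : Prop :=
  exists E F : PG K 1, E != F /\
  exists H : {group {perm PG K 1}},
    [/\ H \subset pgroup_fixing E F, #|H| = (\sum_(i < t) q ^ i)%N &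
        exists P, [/\ P != E, P != F & D = orbit 'P H P]].

Definition andre_std (delta : K) : {set PG K 1} :=
  [set P : PG K 1 | [exists theta : K, [&& theta != 0, norm theta == delta &
                                          val P == <[vec2 1 theta]>%VS]]].

Definition Xsub (m : nat) (u : K) : {set 'rV[K]_2} :=
  [set vec2 s (s ^+ (q ^ m) * u) | s : K].

Definition std_net (m : nat) (delta : K) : {set {set 'rV[K]_2}} :=
  [set Xsub m u | u : K in [pred u | (u != 0) && (norm u == delta)]].

Definition is_replacement_net (m : nat) (D : {set PG K 1})
    (R : {set {set 'rV[K]_2}}) : Prop :=
  exists (delta : K) (phi : {'GL_2[K]}),
    [/\ delta != 0, delta ^+ q = delta,
        D = projectivity_of phi @: andre_std delta &
        R = [set [set v *m GLval phi | v in X] | X : {set 'rV[K]_2} in std_net m delta]].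

Definition translates (W : {set 'rV[K]_2}) : {set {set 'rV[K]_2}} :=
  [set [set v + w | w in W] | v : 'rV[K]_2].

(* The affine lines of PG(2, K) through the point P at infinity are the cosets
   of P, regarded as a subspace of 'rV[K]_2. *)
Definition andre_affine_lines (D : {set PG K 1}) (R : {set {set 'rV[K]_2}}) :
    {set {set 'rV[K]_2}} :=
  \bigcup_(P : PG K 1 | P \notin D) translates [set v | v \in val P]
    :|: \bigcup_(W in R) translates W.

Definition andre_point : finType := ('rV[K]_2 + {set {set 'rV[K]_2}})%type.

Definition andre_plane_lines (D : {set PG K 1}) (R : {set {set 'rV[K]_2}}) :
    {set {set andre_point}} :=
  completion_lines (andre_affine_lines D R).

Definition andre_image (C : {set PG K 2}) : {set andre_point} :=
  inl @: affine_part C.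

End Andre.

(* Main.v *)
Require Import Defs.
From mathcomp Require Import all_boot all_order all_algebra all_fingroup.
From mathcomp Require Import all_solvable all_field ring.

(* The radical of the polar form of the conic is its nucleus, hence the affine
   part of the conic contains a set {v + s nu + b s^2 tau | s}, where nu and tau
   span N and T.  Undoing the projectivity, tau = (1, theta1) and
   nu = (1, w theta1) with N(theta1) = delta and N(w) = 1.  Since squaring is
   additive, the points with parameters 0, s1/b, s2/b lie on a common block as
   soon as s1 and s2 are roots of u (s + s^2)^sigma = w s + s^2, where
   sigma = q^m and u has norm 1.
   By Hilbert 90 there is s <> 0 with s = w s^sigma; then u = w^2 makes both
   sides equal to w s + s^2, and c s is another root for all c in F_q. *)

Set Implicit Arguments.
Unset Strict Implicit.
Unset Printing Implicit Defensive.

Import GRing.Theory.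
Local Open Scope ring_scope.

(** * Finite fields: characteristic, norms and Hilbert 90 *)

(** The second conjunct is what makes [x ^+ (q ^ m)] additive in [x]. *)
Lemma pchar_even_card (q t : nat) (K : finFieldType) :
    ~~ odd q -> (0 < t)%N -> #|K| = (q ^ t)%N ->
  2 \in [pchar K] /\ [pchar K].-nat q.
Proof.
move=> q_even t_gt0 cardK; have [p p_pr charKp] := finPcharP K.
have := card_pprimeChar charKp; rewrite [X in X = _]cardK.
set n := logn _ _ => qtE.
have p2 : p = 2.
  have : (2 %| p ^ n)%N by rewrite -qtE dvdn_exp // dvdn2.
  by rewrite Euclid_dvdX // dvdn_prime2 // => /andP[/eqP].
rewrite -{1}p2; split=> //; rewrite (eq_pnat _ (pcharf_eq charKp)).
apply: (pnat_dvd (n := (p ^ n)%N)); last by rewrite pnatX pnat_id.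
by rewrite -qtE -{1}[q]expn1 dvdn_exp2l.
Qed.

Lemma finField_prim_root (K : finFieldType) :
  {g : K | #|K|.-1.-primitive_root g}.
Proof.
have K_gt1 : (1 < #|K|)%N := finNzRing_gt1 K.
have unityK : all #|K|.-1.-unity_root (enum (predC1 (0 : K))).
  apply/allP=> a; rewrite mem_enum !inE => a0; apply/unity_rootP/(mulfI a0).
  by rewrite mulr1 -exprS prednK ?expf_card // ltnW.
have K1_gt0 : (0 < #|K|.-1)%N by rewrite -subn1 subn_gt0.
have := has_prim_root K1_gt0 unityK (enum_uniq _).
by rewrite -cardE cardC1 leqnn => /(_ isT) /hasP/sig2W[g _]; exists g.
Qed.

Lemma expf_fixed (K : fieldType) (q i : nat) (c : K) :
  c ^+ q = c -> c ^+ (q ^ i) = c.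
Proof. by move=> cq; elim: i => [|i IH]; rewrite ?expr1 // expnSr exprM IH. Qed.

Lemma exists_fixed_neq01 (K : finFieldType) (q t : nat) :
    (2 < q)%N -> (0 < t)%N -> #|K| = (q ^ t)%N ->
  exists c : K, [/\ c != 0, c != 1 & c ^+ q = c].
Proof.
(* From here on [q] is the predecessor of the original one, so [c] has multiplicative order the
   original [q] minus 1, which exceeds 1. *)
case: q => [|q] // q_gt1 t_gt0 cardK; have [g prim_g] := finField_prim_root K.
have dvd_q : (q %| #|K|.-1)%N by rewrite cardK predn_exp dvdn_mulr.
have prim_c := dvdn_prim_root prim_g dvd_q; set c := g ^+ _ in prim_c.
have c_q := prim_expr_order prim_c.
exists c; split; last by rewrite exprS c_q mulr1.
  by rewrite (prim_root_eq0 prim_c) gtn_eqF // ltnW.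
by rewrite -[c]expr1 -(prim_order_dvd prim_c) gtnNdvd.
Qed.

(** Write [w = g ^+ j] for a generator [g]. Norm 1 means that [(q - 1) * n] divides [j * n], where
    [n] is the exponent of the norm, so [q - 1] divides [j]. *)
Lemma norm1_expB1 (K : finFieldType) (q t : nat) (w : K) :
    (1 < q)%N -> (0 < t)%N -> #|K| = (q ^ t)%N -> norm q t w = 1 ->
  exists2 v : K, v != 0 & w = v ^+ q.-1.
Proof.
move=> q_gt1 t_gt0 cardK norm_w; have [g prim_g] := finField_prim_root K.
have q1_gt0 : (0 < q.-1)%N by rewrite -subn1 subn_gt0.
have cardE : #|K|.-1 = (q.-1 * \sum_(i < t) q ^ i)%N by rewrite cardK predn_exp.
have w_K1 : w ^+ #|K|.-1 = 1 by rewrite cardE mulnC exprM -/(norm q t w) norm_w expr1n.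
have [[j _] /= w_j] := prim_rootP prim_g w_K1.
have sum_gt0 : (0 < \sum_(i < t) q ^ i)%N.
  by case: t t_gt0 {cardK norm_w cardE} => // t _; rewrite big_ord_recl.
have g0 : g != 0 by rewrite (prim_root_eq0 prim_g) cardE -lt0n muln_gt0 q1_gt0.
have : (q.-1 %| j)%N.
  have : g ^+ (j * \sum_(i < t) q ^ i) == 1.
    by rewrite exprM -w_j -/(norm q t w) norm_w.
  rewrite -(prim_order_dvd prim_g) cardE dvdn_pmul2r //.
case/dvdnP=> k jE; exists (g ^+ k); first exact: expf_neq0.
by rewrite w_j jE exprM.
Qed.

(** Let [w = v ^+ (q - 1)] and [a * m = b * t + 1]. The power of [v] with exponent the sum of
    [q ^ (m * i)] over [i < a] works: raising it to [q ^ m - 1] gives [v ^+ (q ^ (a * m) - 1)], and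
    [q ^ (a * m)] acts on the field as [q]. *)
Lemma hilbert90 (K : finFieldType) (q t m : nat) (w : K) :
    (1 < q)%N -> (0 < t)%N -> #|K| = (q ^ t)%N -> (0 < m)%N -> coprime m t ->
    norm q t w = 1 ->
  exists2 s : K, s != 0 & s ^+ (q ^ m) = w * s.
Proof.
move=> q_gt1 t_gt0 cardK m_gt0 co_mt norm_w.
have [v v0 ->] := norm1_expB1 q_gt1 t_gt0 cardK norm_w.
have [a b ab _] := egcdnP t m_gt0.
exists (v ^+ (\sum_(i < a) (q ^ m) ^ i)); first exact: expf_neq0.
(* After multiplication by [v], the left side is the same geometric sum in the exponent with one
   more term, and splitting off that last term leaves [v ^+ q]. *)
apply: (mulfI v0); rewrite mulrA -exprS prednK ?(ltnW q_gt1) // -exprM -exprS -exprD.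
have -> : ((\sum_(i < a) (q ^ m) ^ i) * q ^ m).+1%N = (\sum_(i < a.+1) (q ^ m) ^ i)%N.
  rewrite big_ord_recl add1n big_distrl; congr _.+1.
  by apply: eq_bigr => i _; rewrite lift0 expnSr.
rewrite big_ord_recr /= addnC !exprD; congr (_ * _).
rewrite -expnM mulnC ab (eqP co_mt) addn1 expnS mulnC exprM.
by rewrite mulnC expnM expf_fixed // -cardK expf_card.
Qed.

(** If [r ^+ (q ^ m) = w * r], then every [d / r] with [d] fixed by the [q]-th power is a root. The
    values [d = 1] and [d = c], where [c] is neither 0 nor 1, give two distinct nonzero roots. *)
Lemma two_roots (K : finFieldType) (q t m : nat) (w : K) :
    (2 < q)%N -> [pchar K].-nat q -> (0 < t)%N -> #|K| = (q ^ t)%N ->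
    (0 < m)%N -> coprime m t -> norm q t w = 1 ->
  exists s1 s2 : K, [/\ s1 != 0, s2 != 0, s1 != s2,
    w ^+ 2 * (s1 + s1 ^+ 2) ^+ (q ^ m) = w * s1 + s1 ^+ 2 &
    w ^+ 2 * (s2 + s2 ^+ 2) ^+ (q ^ m) = w * s2 + s2 ^+ 2].
Proof.
move=> q_gt2 charK t_gt0 cardK m_gt0 co_mt norm_w.
have [r r0 rE] := hilbert90 (ltnW q_gt2) t_gt0 cardK m_gt0 co_mt norm_w.
have [c [c0 c1 cq]] := exists_fixed_neq01 q_gt2 t_gt0 cardK.
have w0 : w != 0.
  apply: contraNneq r0 => w0; move/eqP: rE.
  by rewrite w0 mul0r expf_eq0 => /andP[].
have root d : d ^+ q = d -> w ^+ 2 * (d / r + (d / r) ^+ 2) ^+ (q ^ m)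
    = w * (d / r) + (d / r) ^+ 2.
  move=> dq; rewrite exprDn_pchar ?pnatX ?charK // exprAC expr_div_n rE.
  by rewrite (expf_fixed m dq); field; rewrite w0 r0.
exists (1 / r), (c / r); rewrite !mulf_neq0 ?oner_eq0 ?invr_eq0 //; split=> //.
- by rewrite (inj_eq (mulIf _)) ?invr_eq0 // eq_sym.
- by apply: root; rewrite expr1n.
- exact: root.
Qed.

(** * Quadratic forms and their radical in characteristic 2 *)

Lemma polarE (K : finFieldType) (A : 'M[K]_3) (v w : 'rV[K]_3) :
  polar A v w = (v *m A *m w^T + w *m A *m v^T) 0 0.
Proof.
rewrite /polar /quad linearD /= !mulmxDl !mulmxDr !mxE.
ring.
Qed.

Lemma quadD (K : finFieldType) (A : 'M[K]_3) (v w : 'rV[K]_3) :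
  quad A (v + w) = quad A v + quad A w + polar A v w.
Proof. rewrite /polar; ring. Qed.

Lemma quadZ (K : finFieldType) (A : 'M[K]_3) (a : K) (v : 'rV[K]_3) :
  quad A (a *: v) = a ^+ 2 * quad A v.
Proof. by rewrite /quad linearZ /= -!scalemxAl -scalemxAr !mxE mulrA. Qed.

Lemma polarC (K : finFieldType) (A : 'M[K]_3) (v w : 'rV[K]_3) :
  polar A v w = polar A w v.
Proof. by rewrite !polarE addrC. Qed.

Lemma polarDr (K : finFieldType) (A : 'M[K]_3) (v w1 w2 : 'rV[K]_3) :
  polar A v (w1 + w2) = polar A v w1 + polar A v w2.
Proof.
rewrite !polarE linearD /= !mulmxDl !mulmxDr !mxE; ring.
Qed.

Lemma polarZr (K : finFieldType) (A : 'M[K]_3) (a : K) (v w : 'rV[K]_3) :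
  polar A v (a *: w) = a * polar A v w.
Proof.
by rewrite !polarE linearZ /= -!scalemxAl -!scalemxAr !mxE mulrDr.
Qed.

Lemma polar_id (K : finFieldType) (A : 'M[K]_3) (v : 'rV[K]_3) :
  2 \in [pchar K] -> polar A v v = 0.
Proof. by move=> char2; rewrite polarE !mxE (addrr_pchar2 char2). Qed.

(** Squaring is additive with trivial kernel, hence injective, hence bijective on a finite field. *)
Lemma finField_sqrt (K : finFieldType) (a : K) :
  2 \in [pchar K] -> exists b : K, b ^+ 2 = a.
Proof.
move=> char2; have sq_inj : injective (fun x : K => x ^+ 2).
  move=> x y /eqP; rewrite -subr_eq0 (GRing.subr_pchar2 char2) -exprDn_pchar ?pnatE //.
  by rewrite expf_eq0 addr_eq0 (oppr_pchar2 char2) => /eqP.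
by have [f _ fK] := injF_bij sq_inj; exists (f a).
Qed.

(** Indices are residues modulo 3, with -1 the last one; this gives cyclic formulas such as
    [S (i + 1) (i - 1)]. *)
Lemma sum_ord3 (V : zmodType) (F : 'I_3 -> V) : \sum_i F i = F 0 + F 1 + F (-1).
Proof.
rewrite !big_ord_recl big_ord0 addr0 addrA.
by congr (F _ + F _ + F _); apply: val_inj.
Qed.

(* In coordinates, the radical of an alternating form on a 3-space is spanned
   by the vector dual to the form. *)
Lemma exists_radical (K : finFieldType) (A : 'M[K]_3) :
    2 \in [pchar K] -> nondegenerate_quad A ->
  exists2 r : 'rV[K]_3, quad A r != 0 & forall w, polar A r w = 0.
Proof.
move=> char2 ndA; have addxx (x : K) : x + x = 0 by apply: addrr_pchar2.
pose S i j := A i j + A j i.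
have polarS (v w : 'rV[K]_3) : polar A v w =
      (v 0 0 * w 0 1 + v 0 1 * w 0 0) * S 0 1
    + (v 0 1 * w 0 (-1) + v 0 (-1) * w 0 1) * S 1 (-1)
    + (v 0 (-1) * w 0 0 + v 0 0 * w 0 (-1)) * S (-1) 0.
  set rhs := RHS.
  (* The expansion of the polar form also has doubled diagonal terms, which vanish in characteristic
     2; adding them leaves an identity over any commutative ring. *)
  have -> : rhs = rhs + (v 0 0 * w 0 0 * A 0 0 + v 0 0 * w 0 0 * A 0 0)
     + (v 0 1 * w 0 1 * A 1 1 + v 0 1 * w 0 1 * A 1 1)
     + (v 0 (-1) * w 0 (-1) * A (-1) (-1) + v 0 (-1) * w 0 (-1) * A (-1) (-1)).
    by rewrite !addxx !addr0.
  rewrite polarE !(mxE, sum_ord3) /rhs /S; ring.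
pose r : 'rV[K]_3 := \row_i S (i + 1) (i - 1).
have r0 : r 0 0 = S 1 (-1) by rewrite mxE; congr S; apply: val_inj.
have r1 : r 0 1 = S (-1) 0 by rewrite mxE; congr S; apply: val_inj.
have r2 : r 0 (-1) = S 0 1 by rewrite mxE; congr S; apply: val_inj.
have rad_r w : polar A r w = 0.
  rewrite polarS r0 r1 r2.
  set a := S 0 1; set b := S 1 (-1); set c := S (-1) 0.
  transitivity ((a * b + a * b) * w 0 1 + (a * c + a * c) * w 0 0
    + (b * c + b * c) * w 0 (-1)); first by ring.
  by rewrite !addxx !mul0r !addr0.
have [Qr|Qr] := eqVneq (quad A r) 0; last by exists r.
(* In this case the polar form vanishes identically, so the form is additive. A combination of [e0]
   and [e1] with suitable square roots as coefficients is then singular, which forces [e0 = 0]. *)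
have r_eq0 : r = 0 by apply: ndA.
have polar0 v w : polar A v w = 0.
  by rewrite polarS -r0 -r1 -r2 r_eq0 !mxE !mulr0 !addr0.
have singular v : quad A v = 0 -> v = 0 by move=> Qv; apply: ndA.
pose e0 : 'rV[K]_3 := delta_mx 0 0; pose e1 : 'rV[K]_3 := delta_mx 0 1.
have [[x xE] [y yE]] := (finField_sqrt (quad A e1) char2, finField_sqrt (quad A e0) char2).
have : x *: e0 + y *: e1 = 0.
  by apply: singular; rewrite quadD polar0 addr0 !quadZ xE yE mulrC addxx.
move/rowP=> v0; have := v0 1; have := v0 0.
rewrite !mxE /= !mulr1 !mulr0 addr0 add0r => x0 y0; move: yE.
rewrite y0 expr0n => /esym/singular/rowP/(_ 0); rewrite !mxE /= => /eqP.
by rewrite oner_eq0.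
Qed.

(** * The nucleus and the affine points of a conic *)

Lemma memv_line2 (K : fieldType) (vT : vectType K) (a b v : vT) :
  v \in (<[a]> + <[b]>)%VS -> exists x y, v = x *: a + y *: b.
Proof. by case/memv_addP=> _ /vlineP[x ->] [_ /vlineP[y ->] ->]; exists x, y. Qed.

Lemma dim1_vline (K : fieldType) (vT : vectType K) (V : {vspace vT}) (v : vT) :
  \dim V = 1%N -> v \in V -> v != 0 -> V = <[v]>%VS.
Proof.
by move=> V1 vV v0; apply/esym/eqP; rewrite eqEdim -memvE vV V1 dim_vline v0.
Qed.

Lemma dim1_vline_exists (K : fieldType) (vT : vectType K) (V : {vspace vT}) :
  \dim V = 1%N -> exists2 v, v != 0 & V = <[v]>%VS.
Proof.
move=> V1; have v0 : vpick V != 0 by rewrite vpick0 -dimv_eq0 V1.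
by exists (vpick V); last exact: dim1_vline (memv_pick V) v0.
Qed.

Lemma quad_eq0_on_line (K : finFieldType) (A : 'M[K]_3) (P : PG K 2) (v : 'rV[K]_3) :
    val P = <[v]>%VS ->
  [forall w : 'rV[K]_3, (w \in val P) ==> (quad A w == 0)] = (quad A v == 0).
Proof.
move=> ->; apply/forallP/idP=> [/(_ v)|/eqP Qv w]; first by rewrite memv_line.
by apply/implyP=> /vlineP[k ->]; rewrite quadZ Qv mulr0.
Qed.

(** Let [r] span the radical. On a line through [r] the form is the square of a linear form, so the
    line is tangent. If [n] were not a multiple of [r], a line through [r] and a point [p] outside
    the span of [r] and [n] would be a tangent missing [N]. *)
Lemma nucleus_radical (K : finFieldType) (A : 'M[K]_3) (C : {set PG K 2})
    (N : PG K 2) (n : 'rV[K]_3) :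
    2 \in [pchar K] -> nondegenerate_quad A ->
    C = [set P : PG K 2 | [forall v : 'rV[K]_3, (v \in val P) ==> (quad A v == 0)]] ->
    is_nucleus C N -> n != 0 -> val N = <[n]>%VS ->
  quad A n != 0 /\ forall w, polar A n w = 0.
Proof.
move=> char2 ndA CE nucN n0 NE.
have [r Qr rad_r] := exists_radical char2 ndA.
suff /vlineP[k nE] : n \in <[r]>%VS.
  rewrite nE quadZ; split=> [|w]; last by rewrite polarC polarZr polarC rad_r mulr0.
  by rewrite mulf_neq0 // expf_neq0 //; apply: contraNneq n0 => k0; rewrite nE k0 scale0r.
apply/negPn/negP => n_r; have r0 : r != 0.
  by apply: contraNneq Qr => ->; rewrite -(scale0r r) quadZ expr0n mul0r.
have /subvPn[p _ pW] : ~~ ({:'rV[K]_3} <= <[r]> + <[n]>)%VS.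
  apply/negP => /dimvS; rewrite dimvf dim_matrix => le3.
  have := leq_trans le3 (dimv_add_leqif _ _).1; rewrite !dim_vline.
  by case: (r != 0); case: (n != 0).
pose U := (<[r]> + <[p]>)%VS.
have p_r : p \notin <[r]>%VS by apply: contra pW; apply/subvP/addvSl.
have p0 : p != 0 by apply: contraNneq p_r => ->; apply: mem0v.
have rp_free x y : x *: r + y *: p = 0 -> y = 0.
  move=> xy0; apply: contraNeq p_r => y0; apply/vlineP; exists (- (x / y)).
  apply: (scalerI y0); rewrite scalerA mulrN mulrCA divff // mulr1 scaleNr.
  by apply/eqP; rewrite -addr_eq0 addrC xy0.
have dimU : \dim U = 2%N.
  rewrite dimv_disjoint_sum ?dim_vline ?r0 ?p0 //; apply/eqP; rewrite -subv0.
  apply/subvP=> v /memv_capP[/vlineP[x ->] /vlineP[y xy]].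
  have y0 : - y = 0 by apply: (rp_free x); rewrite xy scaleNr subrr.
  by rewrite xy -[y]opprK y0 oppr0 scale0r mem0v.
have [a aE] := finField_sqrt (quad A p) char2.
have [b bE] := finField_sqrt (quad A r) char2.
have b0 : b != 0 by apply: contraNneq Qr => b0; rewrite -bE b0 expr0n.
have quadU x y : quad A (x *: r + y *: p) = (x * b + y * a) ^+ 2.
  rewrite quadD !quadZ polarZr polarC polarZr polarC rad_r !mulr0 addr0 -aE -bE -!exprMn.
  by rewrite exprDn_pchar // pnatE.
(* The zero of the linear form [x * b + y * a], that is, the point of tangency. *)
pose z := a *: r + b *: p.
have z0 : z != 0 by apply: contraNneq b0 => /rp_free->.
pose l : {set PG K 2} := [set P | (val P <= U)%VS].
have tan_l : tangent_at C l (vpt z0).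
  split; first by apply/imsetP; exists U; rewrite // inE dimU.
  apply/setP=> P; have [v v0 PE] := dim1_vline_exists (eqP (valP P)).
  rewrite CE !inE (quad_eq0_on_line A PE) PE -memvE; apply/andP/eqP => [[/eqP Qv vU]|PZ].
    have [x [y vE]] := memv_line2 vU; move/eqP: Qv.
    rewrite vE quadU expf_eq0 /= addr_eq0 (oppr_pchar2 char2) => /eqP xy.
    have zv : b *: v = y *: z by rewrite vE !scalerDr !scalerA mulrC xy mulrC [b * y]mulrC.
    apply: val_inj; rewrite /= PE; apply/esym/dim1_vline; rewrite ?dim_vline ?z0 //.
    apply/vlineP; exists (y / b); apply: (scalerI b0).
    by rewrite zv !scalerA mulrCA divff // mulr1.
  have : v \in val (vpt z0) by rewrite -PZ PE memv_line.
  case/vlineP=> k ->; rewrite quadZ quadU [b * a]mulrC (addrr_pchar2 char2) expr0n mulr0.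
  by split=> //; rewrite memvZ // memv_add ?memvZ ?memv_line.
have := nucN _ _ tan_l; rewrite inE NE -memvE => /memv_line2[x [y nE]].
have y0 : y != 0.
  by apply: contraNneq n_r => y0; rewrite nE y0 scale0r addr0 memvZ ?memv_line.
(* Since [n] lies on the tangent but is not a multiple of [r], it can be exchanged with [p]. *)
case/negP: pW; have -> : p = - (x / y) *: r + y^-1 *: n.
  rewrite nE scalerDr !scalerA mulVf // scale1r addrA -scalerDl mulrC addNr.
  by rewrite scale0r add0r.
by rewrite memv_add ?memvZ ?memv_line.
Qed.

(** With [p = (0, 0, 1)], the form at [p + s nu + c tau] is [Q(p) + s^2 Q(nu) + c B], because [nu]
    is in the radical and [Q(tau) = 0]. Here [B] is the polar form of [tau] and [p]; solving for [c]
    gives [v] and [b]. *)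
Lemma conic_affine_part (K : finFieldType) (C : {set PG K 2}) (T N : PG K 2)
    (tau nu : 'rV[K]_2) :
    2 \in [pchar K] -> is_conic C -> is_nucleus C N -> T \in C ->
    tau != 0 -> nu != 0 -> val T = <[to_inf tau]>%VS -> val N = <[to_inf nu]>%VS ->
  nu \notin <[tau]>%VS /\
  exists v b, b != 0 /\
    forall s, v + s *: nu + (b * s ^+ 2) *: tau \in affine_part C.
Proof.
move=> char2 [A ndA CE] nucN TC tau0 nu0 TE NE.
have inf_neq0 u : u != 0 -> to_inf u != 0 :> 'rV[K]_3.
  by apply: contra_neq => u0; apply: to_inf_inj; rewrite u0 linear0.
have [Qnu rad_nu] := nucleus_radical char2 ndA CE nucN (inf_neq0 _ nu0) NE.
have Qtau : quad A (to_inf tau) = 0.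
  by apply/eqP; rewrite -(quad_eq0_on_line A TE); move: TC; rewrite CE inE.
have nu_tau : nu \notin <[tau]>%VS.
  apply: contraNN Qnu => /vlineP[k ->].
  by rewrite linearZ quadZ Qtau mulr0.
split=> //; pose p : 'rV[K]_3 := @row_mx K 1 2 1 0 1.
have infE a b : a *: to_inf nu + b *: to_inf tau = to_inf (a *: nu + b *: tau).
  by rewrite linearD !linearZ.
have decomp (w : 'rV[K]_3) : exists x y z, w = x *: p + y *: to_inf nu + z *: to_inf tau.
  pose w2 : 'rV[K]_2 := @lsubmx _ 1 2 1 w; pose x := @rsubmx _ 1 2 1 w 0 0.
  have : w2 \in (<[nu]> + <[tau]>)%VS.
    suff -> : (<[nu]> + <[tau]>)%VS = fullv by apply: memvf.
    apply/eqP; rewrite eqEdim subvf dimvf dim_matrix dimv_disjoint_sum.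
      by rewrite !dim_vline nu0 tau0.
    apply/eqP; rewrite -subv0; apply/subvP=> u /memv_capP[/vlineP[y ->] uT].
    have [->|y0] := eqVneq y 0; first by rewrite scale0r mem0v.
    case/negP: nu_tau; move: (memvZ y^-1 uT).
    by rewrite scalerA mulVf // scale1r.
  case/memv_line2=> y [z w2E]; exists x, y, z.
  rewrite -addrA infE -w2E /p (@scale_row_mx _ 1 2 1) scaler0.
  rewrite (@add_row_mx _ 1 2 1) add0r addr0 -[LHS](@hsubmxK _ 1 2 1).
  congr (@row_mx K 1 2 1 _ _).
  by apply/rowP=> i; rewrite /x !mxE ord1 eqxx mulr1.
(* Otherwise [tau] would be orthogonal to the basis [p], [nu], [tau], hence a singular point. *)
have Bp : polar A (to_inf tau) p != 0.
  apply: contraNneq (inf_neq0 _ tau0) => Bp; apply/eqP/ndA => // w.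
  have [x [y [z ->]]] := decomp w.
  rewrite !polarDr !polarZr Bp [polar _ _ (to_inf nu)]polarC rad_nu polar_id //.
  by rewrite !mulr0 !addr0.
pose B := polar A (to_inf tau) p.
exists ((quad A p / B) *: tau), (quad A (to_inf nu) / B); split.
  by rewrite mulf_neq0 ?invr_eq0.
move=> s; rewrite inE CE inE.
set v := (X in aff_pt X).
have vE : @row_mx K 1 2 1 v 1 = p + s *: to_inf nu
   + (quad A p / B + quad A (to_inf nu) / B * s ^+ 2) *: to_inf tau.
  rewrite -addrA infE /p (@add_row_mx _ 1 2 1) add0r addr0.
  by rewrite scalerDl addrCA addrA.
rewrite (@quad_eq0_on_line _ A _ (@row_mx K 1 2 1 v 1)) // vE.
rewrite !quadD !quadZ Qtau !polarZr mulr0 addr0 [polar _ (_ + _) _]polarC.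
rewrite polarDr polarZr [polar _ _ (to_inf nu)]polarC rad_nu mulr0 addr0.
rewrite [polar _ _ (to_inf nu)]polarC rad_nu mulr0 addr0 -/B.
have -> : (quad A p / B + quad A (to_inf nu) / B * s ^+ 2) * B
  = quad A p + s ^+ 2 * quad A (to_inf nu) by field.
by rewrite (addrr_pchar2 char2).
Qed.

(** * Coordinates and norms for the replacement net *)

Lemma vec2D (K : finFieldType) (x y x' y' : K) :
  vec2 x y + vec2 x' y' = vec2 (x + x') (y + y').
Proof. by rewrite /vec2 (@add_row_mx _ 1 1 1) !raddfD. Qed.

Lemma vec2Z (K : finFieldType) (a x y : K) : a *: vec2 x y = vec2 (a * x) (a * y).
Proof. by rewrite /vec2 (@scale_row_mx _ 1 1 1) !scale_scalar_mx. Qed.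

Lemma vec2_neq0 (K : finFieldType) (theta : K) : vec2 1 theta != 0.
Proof.
apply/eqP => /rowP /(_ (lshift 1 (0 : 'I_1))); rewrite (@row_mxEl _ 1 1 1) !mxE eqxx.
by move/eqP; rewrite oner_eq0.
Qed.

Lemma normM (K : finFieldType) (q t : nat) (a b : K) :
  norm q t (a * b) = norm q t a * norm q t b.
Proof. exact: exprMn. Qed.

(** The exponent of the norm times [q ^ m - 1] is a multiple of [q ^ t - 1]. This allows the
    coefficient [b] of the conic to be absorbed into [u] without changing its norm. *)
Lemma norm_expB1 (K : finFieldType) (q t m : nat) (a : K) :
  (0 < q)%N -> #|K| = (q ^ t)%N -> a != 0 -> norm q t (a ^+ (q ^ m - 1)) = 1.
Proof.
move=> q_gt0 cardK a0; rewrite /norm subn1 predn_exp -!exprM mulnAC -predn_exp.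
suff aK : a ^+ (q ^ t).-1 = 1 by rewrite exprM aK expr1n.
by apply: (mulfI a0); rewrite -exprS prednK ?expn_gt0 ?q_gt0 // -cardK expf_card mulr1.
Qed.

Lemma mem_andre_set (K : finFieldType) (q t : nat) (delta : K)
    (phi : {'GL_2[K]}) (T : PG K 2) :
    T \in [set inf_pt P | P in projectivity_of phi @: andre_std q t delta] ->
  exists theta, [/\ theta != 0, norm q t theta = delta &
    val T = <[to_inf (vec2 1 theta *m GLval phi)%R]>%VS].
Proof.
case/imsetP=> _ /imsetP[P + ->] ->; rewrite inE.
case/existsP=> theta /and3P[theta0 /eqP norm_theta /eqP PE].
by exists theta; rewrite /= PE !limg_line !lfunE.
Qed.

Theorem theorem7 (q t : nat) (K : finFieldType)
    (q_even : ~~ odd q) (t_prime : prime t) (t_ge3 : (3 <= t)%N)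
    (q_ge_t : (t <= q)%N) (cardK : #|K| = (q ^ t)%N)
    (C : {set PG K 2}) (D : {set PG K 1}) (T N : PG K 2)
    (conicC : is_conic C) (andreD : is_andre_set q t D)
    (nucleusN : is_nucleus C N) (tangentT : tangent_at C (linf K) T)
    (TD : T \in [set inf_pt P | P in D]) (ND : N \in [set inf_pt P | P in D])
    (m : nat) (m_gt0 : (1 <= m)%N) (m_lt : (m <= t - 1)%N)
    (R : {set {set 'rV[K]_2}}) (netR : is_replacement_net q t m D R) :
  ~ is_arc (andre_plane_lines D R) (andre_image C).
Proof.
have t_gt0 := prime_gt0 t_prime; have q_gt2 := leq_trans t_ge3 q_ge_t.
have co_mt : coprime m t.
  by rewrite coprime_sym prime_coprime // gtnNdvd // (leq_ltn_trans m_lt) // subn1 prednK.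
have [char2 charK] := pchar_even_card q_even t_gt0 cardK.
have [delta [phi [delta0 _ DE RE]]] := netR; rewrite DE in TD ND.
have [theta1 [theta10 norm1 TE]] := mem_andre_set TD.
have [theta2 [theta20 norm2 NE]] := mem_andre_set ND.
have phiU : GLval phi \in unitmx by apply: GL_unitmx.
have dir_neq0 theta : vec2 1 theta *m GLval phi != 0.
  apply: contraTneq (vec2_neq0 theta) => e.
  by rewrite -(mulmxK phiU (vec2 _ _)) e mul0mx eqxx.
have TC : T \in C.
  by have [_ /setP/(_ T)] := tangentT; rewrite in_setI set11 => /andP[].
have [indep [v [b [b0 ptC]]]] :=
  conic_affine_part char2 conicC nucleusN TC (dir_neq0 _) (dir_neq0 _) TE NE.
pose pt s := v + s *: (vec2 1 theta2 *m GLval phi)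
               + (b * s ^+ 2) *: (vec2 1 theta1 *m GLval phi).
(* The two directions are independent, so the coefficient [s] can be recovered from the point. *)
have pt_inj : injective pt.
  move=> s s'; rewrite /pt -!addrA => /addrI/esym/eqP.
  rewrite [eqbLHS]addrC -subr_eq addrAC eq_sym -subr_eq -!scalerBl => /eqP eq_pt.
  apply: contraNeq indep; rewrite -subr_eq0 => ss'; apply/vlineP.
  exists ((b * s' ^+ 2 - b * s ^+ 2) / (s - s')).
  by apply: (scalerI ss'); rewrite eq_pt scalerA [(s - s') * _]mulrCA divff ?mulr1.
have [w wE] : exists w, theta2 = w * theta1 by exists (theta2 / theta1); rewrite divfK.
have w0 : w != 0 by apply: contraNneq theta20 => w0; rewrite wE w0 mul0r.
have norm_w : norm q t w = 1.
  by apply: (mulIf delta0); rewrite mul1r -[in LHS]norm1 -normM -wE.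
have [s1 [s2 [s10 s20 s12 root1 root2]]] :=
  two_roots q_gt2 charK t_gt0 cardK m_gt0 co_mt norm_w.
(* Before applying [phi], [pt (s / b) - v] has coordinates [(s + s^2) / b] and
   [(w s + s^2) theta1 / b]. The last factor of [u] turns the denominator [b ^+ (q ^ m)] of the
   first coordinate's power into [b]. *)
pose u := w ^+ 2 * theta1 * b ^+ (q ^ m - 1).
have norm_u : norm q t u = delta.
  by rewrite !normM norm_expB1 ?(ltnW (ltnW q_gt2)) // norm_w norm1 !mul1r mulr1.
have u0 : u != 0 by rewrite !mulf_neq0 ?expf_neq0 ?invr_eq0.
pose W : {set 'rV[K]_2} := [set x *m GLval phi | x in Xsub q m u].
pose l : {set 'rV[K]_2} := [set v + x | x in W].
have lL : l \in andre_affine_lines D R.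
  rewrite in_setU; apply/orP; right; apply/bigcupP; exists W; last exact: imset_f.
  by rewrite RE; apply/imset_f/imset_f; rewrite inE u0 norm_u eqxx.
have pt_l s : w ^+ 2 * (s + s ^+ 2) ^+ (q ^ m) = w * s + s ^+ 2 -> pt (s / b) \in l.
  move=> root; pose x := (s + s ^+ 2) / b.
  apply/imsetP; exists (vec2 x (x ^+ (q ^ m) * u) *m GLval phi).
    by apply/imset_f/imset_f.
  rewrite /pt -addrA !scalemxAl -mulmxDl !vec2Z vec2D; congr (_ + vec2 _ _ *m _).
    by rewrite /x; field.
  have Qb : b ^+ (q ^ m) = b ^+ (q ^ m - 1) * b.
    by rewrite -exprSr subn1 prednK // expn_gt0 (ltnW (ltnW q_gt2)).
  have -> : x ^+ (q ^ m) * u = w ^+ 2 * (s + s ^+ 2) ^+ (q ^ m) * theta1 / b.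
    by rewrite /x /u expr_div_n Qb; field; rewrite b0 expf_neq0.
  by rewrite root wE; field.
move=> /(_ (inl (pt 0)) (inl (pt (s1 / b))) (inl (pt (s2 / b)))) arc.
have ptS s : inl (pt s) \in andre_image C by apply: imset_f; apply: ptC.
have bV : b^-1 != 0 by rewrite invr_eq0.
have pt_neq s s' : s != s' -> inl (pt s) != inl (pt s') :> andre_point K.
  by apply: contra_neq => -[] /pt_inj.
apply: arc; rewrite ?ptS ?pt_neq //.
- by rewrite eq_sym mulf_neq0.
- by rewrite (inj_eq (mulIf bV)).
- by rewrite eq_sym mulf_neq0.
exists (inr (pclass (andre_affine_lines D R) l) |: inl @: l).
  by rewrite in_setU; apply/orP; right; apply/imsetP; exists l.
split; rewrite in_setU1 /=; apply: imset_f.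
(* The parameter 0 is the trivial root, read as [0 / b]; [0 ^+ (q ^ m)] is 0 because [q ^ m] is
   positive. *)
- rewrite -(mul0r b^-1) pt_l // expr0n addr0 mulr0 addr0 expr0n expn_eq0.
  by rewrite gtn_eqF ?mulr0 // (ltnW (ltnW q_gt2)).
- exact: pt_l.
- exact: pt_l.
Qed.
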